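(* Let $R$ be a commutative ring with nonzero identity, $M$ an $R$-module, $K\subseteq N$ proper submodules of $M$, and $\phi:S(M)\to S(M)\cup\{\emptyset\}$ a function. (1) If $N$ is a $\phi$-classical 1-absorbing prime submodule of $M$, then $N/K$ is a $\phi_K$-classical 1-absorbing prime submodule of $M/K$. (2) If $K\subseteq\phi(N)$ and $N/K$ is a $\phi_K$-classical 1-absorbing prime submodule of $M/K$, then $N$ is a $\phi$-classical 1-absorbing prime submodule of $M$. (3) If $\phi(N)\subseteq K$ and $N$ is a $\phi$-classical 1-absorbing prime submodule of $M$, then $N/K$ is a weakly classical 1-absorbing prime submodule of $M/K$. (4) If $\phi(K)\subseteq\phi(N)$, $K$ is a $\phi$-classical 1-absorbing prime submodule of $M$ and $N/K$ is a weakly classical 1-absorbing prime submodule of $M/K$, then $N$ is a $\phi$-classical 1-absorbing prime submodule of $M$. (5) If $N$ is a $\phi$-classical 1-absorbing prime submodule of $M$ and $\phi(N)$ is a classical 1-absorbing prime submodule of $M$, then $N$ is a classical 1-absorbing prime submodule of $M$.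
   Context: All modules are unitary. $S(M)$ is the set of all submodules of $M$. Standing assumption: $\phi(N)\subseteq N$ for every submodule $N$. A proper submodule $N$ of $M$ is $\phi$-classical 1-absorbing prime if whenever $a,b,c\in R$ are nonunits and $m\in M$ with $abcm\in N\setminus\phi(N)$, then $abm\in N$ or $cm\in N$. The case $\phi(N)=\emptyset$ for all $N$ defines classical 1-absorbing prime submodules, and the case $\phi(N)=\{0\}$ for all $N$ defines weakly classical 1-absorbing prime submodules. The function $\phi_K:S(M/K)\to S(M/K)\cup\{\emptyset\}$ is defined by $\phi_K(N/K)=(\phi(N)+K)/K$ for every submodule $N\supseteq K$ of $M$, with $\phi_K(N/K)=\emptyset$ if $\phi(N)=\emptyset$. *)

(* Defs.v *)
From HB Require Import structures.
From mathcomp Require Import all_boot all_order all_algebra.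
From mathcomp Require Import boolp.

Set Implicit Arguments.
Unset Strict Implicit.
Unset Printing Implicit Defensive.

Import GRing.Theory.
Local Open Scope ring_scope.
Local Open Scope quotient_scope.

(* S(M) is [submodClosed M].  Its elements carry boolean membership predicates; *)
(* under the classical axioms of boolp these represent all submodules, with no  *)
(* decidability restriction, and [submod_eqP] shows that they are extensional.  *)
Lemma submod_eqP (R : pzRingType) (M : lmodType R) (N L : submodClosed M) :
  (N =i L) <-> N = L.
Proof.
split=> [|-> //]; case: N L => [n [[n0] [n1]]] [l [[l0] [l1]]] eqNL.
have e : n = l by apply: funext => x; exact: eqNL.
case: l / e l0 l1 {eqNL} => l0 l1.
by rewrite (Prop_irrelevance n0 l0) (Prop_irrelevance n1 l1).
Qed.

Section Submodules.
Variables (R : pzRingType) (M : lmodType R).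
Implicit Types N P K : submodClosed M.

Definition proper_submod N : Prop := exists m : M, m \notin N.

Definition submod0_pred : pred M := fun x => x == 0.

Fact submod0_closed : submod_closed submod0_pred.
Proof.
split=> [|a x y]; first exact: eqxx.
by move=> /eqP -> /eqP ->; rewrite scaler0 addr0; exact: eqxx.
Qed.

Definition submod0 : submodClosed M :=
  HB.pack submod0_pred (GRing.isSubmodClosed.Build R M _ submod0_closed).

Definition addsub_pred P K : pred M :=
  fun x => `[< exists p k, [/\ p \in P, k \in K & x = p + k] >].

Fact addsub_closed P K : submod_closed (addsub_pred P K).
Proof.
split=> [|a x y]; first by apply/asboolP; exists 0, 0; rewrite !rpred0 addr0.
move=> /asboolP[p [k [pP kK ->]]] /asboolP[q [l [qP lK ->]]].
apply/asboolP; exists (a *: p + q), (a *: k + l).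
split; [exact/rpredD/qP/rpredZ | exact/rpredD/lK/rpredZ |].
by rewrite scalerDr addrACA.
Qed.

Definition addsub P K : submodClosed M :=
  HB.pack (addsub_pred P K)
    (GRing.isSubmodClosed.Build R M _ (addsub_closed P K)).

(* An element of S(M) \cup {\emptyset}, [None] being the empty set, as a subset *)
(* of M.                                                                        *)
Definition osub (o : option (submodClosed M)) : {pred M} :=
  if o is Some P then mem P else pred0.

Definition submod_zmod K : zmodClosed M :=
  HB.pack (K : {pred M})
    (GRing.isZmodClosed.Build M _ (GRing.submod_closedB (submodClosedP K))).

Definition quotmod K : Type := Quotient.quot (submod_zmod K).

End Submodules.

Section QuotientModule.
Variables (R : pzRingType) (M : lmodType R) (K : submodClosed M).
Local Notation MK := (quotmod K).

HB.instance Definition _ := GRing.Zmodule.on MK.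
HB.instance Definition _ :=
  EqQuotient.copy MK (Quotient.quot (submod_zmod K)).
HB.instance Definition _ :=
  ZmodQuotient.copy MK (Quotient.quot (submod_zmod K)).

Lemma quotmod_eq (x y : M) : (\pi_MK x == \pi_MK y) = (x - y \in K).
Proof. by rewrite -(Quotient.idealrBE (submod_zmod K)). Qed.

Lemma quotmodW (P : MK -> Prop) :
  (forall x : M, P (\pi_MK x)) -> forall u : MK, P u.
Proof. by move=> Px u; rewrite -[u]reprK; apply: Px. Qed.

Definition quot_scale (a : R) (u : MK) : MK := \pi_MK (a *: repr u).

Lemma quot_scale_pi (a : R) (x : M) : quot_scale a (\pi x) = \pi_MK (a *: x).
Proof.
apply/eqP; rewrite quotmod_eq -scalerBr; apply: rpredZ.
by rewrite -quotmod_eq reprK.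
Qed.

Fact quot_scaleA a b u : quot_scale a (quot_scale b u) = quot_scale (a * b) u.
Proof. by move: u; apply: quotmodW => x; rewrite (quot_scale_pi b) !quot_scale_pi scalerA. Qed.

Fact quot_scale1 : left_id 1 quot_scale.
Proof. by apply: quotmodW => x; rewrite quot_scale_pi scale1r. Qed.

Fact quot_scaleDr : right_distributive quot_scale +%R.
Proof.
move=> a; apply: quotmodW => x; apply: quotmodW => y.
by rewrite -raddfD !quot_scale_pi scalerDr raddfD.
Qed.

Fact quot_scaleDl u : {morph quot_scale^~ u : a b / a + b}.
Proof.
by move: u; apply: quotmodW => x a b; rewrite !quot_scale_pi scalerDl raddfD.
Qed.

HB.instance Definition _ := GRing.Zmodule_isLmodule.Build R MK
  quot_scaleA quot_scale1 quot_scaleDr quot_scaleDl.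

Definition quotmk (x : M) : MK := \pi_MK x.

Fact quotmk_is_linear : linear quotmk.
Proof.
move=> a x y; rewrite /quotmk raddfD; congr (_ + _).
exact: (esym (quot_scale_pi a x)).
Qed.

HB.instance Definition _ :=
  GRing.isLinear.Build R M MK *:%R quotmk quotmk_is_linear.

Lemma quotmk_eq (x y : M) : (quotmk x == quotmk y) = (x - y \in K).
Proof. exact: quotmod_eq. Qed.

Lemma quotmkP (P : MK -> Prop) :
  (forall x : M, P (quotmk x)) -> forall u : MK, P u.
Proof. exact: quotmodW. Qed.

Definition quotsub_pred (N : submodClosed M) : pred MK :=
  fun u => `[< exists2 x, x \in N & u = quotmk x >].

Fact quotsub_closed N : submod_closed (quotsub_pred N).
Proof.
split=> [|a u v].
  by apply/asboolP; exists 0; rewrite ?rpred0 // linear0.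
move=> /asboolP[x xN ->] /asboolP[y yN ->]; apply/asboolP.
exists (a *: x + y); first exact/rpredD/yN/rpredZ.
by rewrite linearP.
Qed.

(* N / K for K \subseteq N; in general, (N + K) / K *)
Definition quotsub (N : submodClosed M) : submodClosed MK :=
  HB.pack (quotsub_pred N)
    (GRing.isSubmodClosed.Build R MK _ (quotsub_closed N)).

Definition comap_pred (L : submodClosed MK) : pred M := fun x => quotmk x \in L.

Fact comap_closed L : submod_closed (comap_pred L).
Proof.
split=> [|a x y]; first by rewrite -topredE /= /comap_pred linear0 rpred0.
rewrite -!topredE /= /comap_pred linearP => xL yL.
exact/rpredD/yL/rpredZ.
Qed.

(* The unique N \supseteq K such that N / K = L *)
Definition comap (L : submodClosed MK) : submodClosed M :=
  HB.pack (comap_pred L) (GRing.isSubmodClosed.Build R M _ (comap_closed L)).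

Lemma sub_comap (L : submodClosed MK) : {subset K <= comap L}.
Proof.
move=> x xK; rewrite -topredE /= /comap_pred.
suff /eqP -> : quotmk x == 0 by exact: rpred0.
by rewrite -(linear0 quotmk) quotmk_eq subr0.
Qed.

Lemma comapK (L : submodClosed MK) : quotsub (comap L) = L.
Proof.
apply/submod_eqP => u; apply/asboolP/idP => [[x xL ->] //|].
by move: u; apply: quotmkP => x xL; exists x.
Qed.

Lemma quotsubK (N : submodClosed M) :
  {subset K <= N} -> comap (quotsub N) = N.
Proof.
move=> KN; apply/submod_eqP => x; apply/asboolP/idP => [[y yN]|xN].
  move/eqP; rewrite quotmk_eq => /KN xyN.
  by rewrite -(subrK y x); exact: rpredD.
by exists x.
Qed.

Variable phi : submodClosed M -> option (submodClosed M).

Definition phi_quot (L : submodClosed MK) : option (submodClosed MK) :=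
  omap (fun P => quotsub (addsub P K)) (phi (comap L)).

Lemma phi_quotE (N : submodClosed M) : {subset K <= N} ->
  phi_quot (quotsub N) = omap (fun P => quotsub (addsub P K)) (phi N).
Proof. by move=> KN; rewrite /phi_quot quotsubK. Qed.

End QuotientModule.

Arguments phi_quot {R M} K phi L.

Section Classical1AbsorbingPrime.
Variables (R : comUnitRingType) (M : lmodType R).
Implicit Types (phi : submodClosed M -> option (submodClosed M)).
Implicit Types (N : submodClosed M).

Definition phi_classical_1absorbing_prime phi N : Prop :=
  proper_submod N /\
  forall (a b c : R) (m : M),
    a \isn't a GRing.unit -> b \isn't a GRing.unit -> c \isn't a GRing.unit ->
    (a * b * c) *: m \in N -> (a * b * c) *: m \notin osub (phi N) ->
    (a * b) *: m \in N \/ c *: m \in N.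

Definition classical_1absorbing_prime N : Prop :=
  phi_classical_1absorbing_prime (fun=> None) N.

Definition weakly_classical_1absorbing_prime N : Prop :=
  phi_classical_1absorbing_prime (fun=> Some (submod0 M)) N.

End Classical1AbsorbingPrime.

(* Main.v *)
Require Import Defs.
From HB Require Import structures.
From mathcomp Require Import all_boot all_order all_algebra.

From mathcomp Require Import boolp.

Set Implicit Arguments.
Unset Strict Implicit.
Unset Printing Implicit Defensive.

Import GRing.Theory.
Local Open Scope ring_scope.

Section Quotient.
Variables (R : pzRingType) (M : lmodType R) (K : submodClosed M).
Implicit Types N P : submodClosed M.

(** Since [K] lies in [N], the class of [x] is in [N/K] exactly when [x] is in [N] ([mem_quotsub]).
    The absorbing conditions for [N] and [N/K] thus differ only in the set of excluded products, and
    each passage is a comparison of these sets: [quotsub_phi_classical] goes down to the quotient,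
    [phi_classical_lift_quotsub] goes back up. In (4) and (5) a product may also fall in a smaller
    submodule, [K] or [phi N], whose own primeness then settles the case. *)

Lemma mem_quotsub N (x : M) :
  {subset K <= N} -> (quotmk K x \in quotsub K N) = (x \in N).
Proof. by move=> KN; rewrite -[in RHS](quotsubK KN). Qed.

Lemma proper_quotsub N :
  {subset K <= N} -> proper_submod (quotsub K N) <-> proper_submod N.
Proof.
move=> KN; split=> [[u]|[x xN]]; last by exists (quotmk K x); rewrite mem_quotsub.
by move: u; apply: quotmkP => x; rewrite mem_quotsub // => xN; exists x.
Qed.

Lemma mem_quotmk0 (x : M) : (quotmk K x \in submod0 (quotmod K)) = (x \in K).
Proof.
rewrite -[LHS]/(quotmk K x == 0).
by rewrite -(linear0 (quotmk K)) quotmk_eq subr0.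
Qed.

Lemma mem_addsubl P (x : M) : x \in P -> x \in addsub P K.
Proof.
by move=> xP; apply/asboolP; exists x, 0; rewrite rpred0 addr0.
Qed.

Lemma sub_addsubr P : {subset K <= addsub P K}.
Proof.
by move=> x xK; apply/asboolP; exists 0, x; rewrite rpred0 add0r.
Qed.

Lemma addsub_id P : {subset K <= P} -> addsub P K = P.
Proof.
move=> KP; apply/submod_eqP => x; apply/idP/idP; last exact: mem_addsubl.
by move=> /asboolP[p [k [pP /KP kP ->]]]; exact: rpredD.
Qed.

End Quotient.

Section QuotientPrime.
Variables (R : comUnitRingType) (M : lmodType R) (K N : submodClosed M).
Variable phi : submodClosed M -> option (submodClosed M).
Hypothesis sub_KN : {subset K <= N}.

(** Excluding more products only weakens the condition. Leaving [psi] arbitrary covers both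
    [phi_quot] and the constant zero submodule. *)
Lemma quotsub_phi_classical
    (psi : submodClosed (quotmod K) -> option (submodClosed (quotmod K))) :
  (forall x, x \in osub (phi N) -> quotmk K x \in osub (psi (quotsub K N))) ->
  phi_classical_1absorbing_prime phi N ->
  phi_classical_1absorbing_prime psi (quotsub K N).
Proof.
move=> phi_psi [Nproper Nprime]; split; first exact/proper_quotsub.
move=> a b c u ua ub uc; move: u; apply: quotmkP => m.
rewrite -!linearZ /= !mem_quotsub // => abcN abcNpsi.
by apply: Nprime => //; apply: contra abcNpsi; exact: phi_psi.
Qed.

(** Stated for a single product because in (4) only the products outside [K] can be handled in the
    quotient. *)
Lemma phi_classical_lift_quotsub
    (psi : submodClosed (quotmod K) -> option (submodClosed (quotmod K)))
    (a b c : R) (m : M) :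
  phi_classical_1absorbing_prime psi (quotsub K N) ->
  a \isn't a GRing.unit -> b \isn't a GRing.unit -> c \isn't a GRing.unit ->
  (a * b * c) *: m \in N ->
  quotmk K ((a * b * c) *: m) \notin osub (psi (quotsub K N)) ->
  (a * b) *: m \in N \/ c *: m \in N.
Proof.
move=> [_ prime] ua ub uc; have := prime a b c (quotmk K m) ua ub uc.
by rewrite -!linearZ /= !mem_quotsub.
Qed.

End QuotientPrime.

Theorem theorem3 (R : comUnitRingType) (M : lmodType R)
    (K N : submodClosed M)
    (phi : submodClosed M -> option (submodClosed M))
    (phi_sub : forall L : submodClosed M, {subset osub (phi L) <= L})
    (K_proper : proper_submod K) (N_proper : proper_submod N)
    (sub_KN : {subset K <= N}) :
  [/\ (phi_classical_1absorbing_prime phi N ->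
        phi_classical_1absorbing_prime (phi_quot K phi) (quotsub K N)),
      ({subset K <= osub (phi N)} ->
        phi_classical_1absorbing_prime (phi_quot K phi) (quotsub K N) ->
        phi_classical_1absorbing_prime phi N),
      ({subset osub (phi N) <= K} ->
        phi_classical_1absorbing_prime phi N ->
        weakly_classical_1absorbing_prime (quotsub K N)),
      ({subset osub (phi K) <= osub (phi N)} ->
        phi_classical_1absorbing_prime phi K ->
        weakly_classical_1absorbing_prime (quotsub K N) ->
        phi_classical_1absorbing_prime phi N)
    & (phi_classical_1absorbing_prime phi N ->
        (exists2 P : submodClosed M,
           phi N = Some P & classical_1absorbing_prime P) ->
        classical_1absorbing_prime N)].
Proof.
split.
- apply: quotsub_phi_classical => // x; rewrite phi_quotE //.
  case: (phi N) => //= P xP; rewrite mem_quotsub; last exact: sub_addsubr.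
  exact: mem_addsubl.
- move=> KphiN prime; split=> // a b c m ua ub uc abcN abcNphi.
  apply: (phi_classical_lift_quotsub sub_KN prime) => //; rewrite phi_quotE //.
  case: (phi N) KphiN abcNphi => //= P KP.
  (* As [K] lies in [P], [P + K] is [P], so a product outside [P] has its class outside [P/K]. *)
  by rewrite addsub_id // mem_quotsub.
- move=> phiNK; apply: quotsub_phi_classical => // x /phiNK xK.
  by rewrite /= mem_quotmk0.
- move=> phiKN [_ Kprime] prime; split=> // a b c m ua ub uc abcN abcNphi.
  (* Inside [K], the primeness of [K] applies because [phi K] lies in [phi N]; outside [K], the
     product has a nonzero class. *)
  have [abcK|abcNK] := boolP ((a * b * c) *: m \in K).
    have abcNphiK : (a * b * c) *: m \notin osub (phi K).
      by apply: contra abcNphi; exact: phiKN.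
    by have [|] := Kprime a b c m ua ub uc abcK abcNphiK => /sub_KN; [left|right].
  apply: (phi_classical_lift_quotsub sub_KN prime) => //=.
  by rewrite mem_quotmk0.
- move=> [_ Nprime] [P phiN [_ Pprime]]; split=> // a b c m ua ub uc abcN _.
  have PN : {subset P <= N} by have := phi_sub N; rewrite phiN.
  (* Products in [P = phi N], which [Nprime] excludes, are exactly those that [Pprime] handles; its
     conclusion passes to [N] by [PN]. *)
  have [abcP|abcNP] := boolP ((a * b * c) *: m \in P).
    by have [//||] := Pprime a b c m ua ub uc abcP => /PN; [left|right].
  by apply: Nprime => //; rewrite phiN.
Qed.
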